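(* Let $A$ and $B$ be $n\times n$ upper triangular complex matrices, each of which is indecomposable with respect to similarity. Then $A$ and $B$ are unitarily similar if and only if $$\|h(A_k)\|=\|h(B_k)\|\qquad\text{for all } h\in\mathbb C[x]\text{ and } k=1,\dots,n,$$ where $A_k$ and $B_k$ are the principal $k\times k$ submatrices of $A$ and $B$.
   Context: All matrices are complex. Square matrices $A,B$ of the same size are unitarily similar if $U^{-1}AU=B$ for some unitary matrix $U$. A square matrix is indecomposable with respect to similarity if it is not similar to a direct sum of square matrices of smaller sizes (equivalently, it is similar to a single Jordan block). The principal $k\times k$ submatrix $M_k$ of a matrix $M$ is the submatrix at the intersection of its first $k$ rows and first $k$ columns. $\|M\|=\sqrt{\sum_{i,j}|m_{ij}|^2}$ is the Frobenius norm. *)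

(* Defs.v *)
From mathcomp Require Import all_boot all_order all_algebra.
From mathcomp Require Import reals complex.

Set Implicit Arguments.
Unset Strict Implicit.
Unset Printing Implicit Defensive.

Import Order.TTheory GRing.Theory Num.Theory.
Local Open Scope ring_scope.

(* [is_trig_mx] means lower triangular, hence the transpose. *)
Definition is_upper_trig_mx (F : fieldType) (n : nat) (A : 'M[F]_n) : bool :=
  is_trig_mx A^T.

(* Two summands suffice, since the blocks of a longer direct sum can be grouped.
   As p + q = n, the bounds p < n and q < n force both summands to be nonempty. *)
Definition indecomposable_mx (F : fieldType) (n : nat) (A : 'M[F]_n) : Prop :=
  forall (p q : nat) (e : (p + q)%N = n) (D1 : 'M[F]_p) (D2 : 'M[F]_q),
    (p < n)%N -> (q < n)%N ->
    ~ similar_in unitmx A (castmx (e, e) (block_mx D1 0 0 D2)).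

Definition unitarily_similar (C : numClosedFieldType) (n : nat)
    (A B : 'M[C]_n) : Prop :=
  exists2 U : 'M[C]_n, U \is unitarymx & invmx U *m A *m U = B.

(* The index is shifted: for i : 'I_n this is the principal submatrix of size
   i.+1, so that its type carries a ring structure and polynomials can be
   evaluated at it. *)
Definition principal_mx (F : fieldType) (n : nat) (i : 'I_n) (M : 'M[F]_n) :
    'M[F]_i.+1 :=
  mxsub (widen_ord (ltn_ord i)) (widen_ord (ltn_ord i)) M.

Definition frobenius_norm (C : numClosedFieldType) (m n : nat)
    (M : 'M[C]_(m, n)) : C :=
  sqrtC (\sum_(i < m) \sum_(j < n) `|M i j| ^+ 2).

(* Main.v *)
Require Import Defs.
From mathcomp Require Import all_boot all_order all_algebra.
From mathcomp Require Import reals complex.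
From mathcomp Require Import zify ring.

Local Open Scope ring_scope.
Set Implicit Arguments.
Unset Strict Implicit.
Unset Printing Implicit Defensive.
Import Order.TTheory GRing.Theory Num.Theory.

(** An indecomposable upper triangular matrix has a single eigenvalue [a] and
    its nilpotent part [N = A - a] satisfies [N ^+ (n - 1) <> 0]: otherwise some
    idempotent other than 0 and 1 commutes with [A], and the row spaces of
    that idempotent and of its complement split [A]
    ([indecomposable_idempotent]).  If there are two eigenvalues, Bezout's
    identity gives such an idempotent as a polynomial in [A]
    ([idempotent_of_two_eigenvalues]); if [N] dies too early, a longest nonzero
    orbit of [N] has an [N]-stable complement ([idempotent_of_nilpotent]).
    As [N] is strictly upper triangular, [N ^+ (n - 1) <> 0] forces every entry
    [(N ^+ k) 0 k] to be nonzero ([corner_neq0]).  The matrix [krylov N], whose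
    row [b] is the first row of [N ^+ b], is then upper triangular and
    invertible, and both directions are read off from it.

    Necessity.  If [A *m U = U *m B] with [U] unitary, comparing traces shows
    that [A] and [B] have the same eigenvalue, so [U] intertwines the nilpotent
    parts [N] and [M].  Then [krylov N *m U] is upper triangular, hence so is
    [U]; the same applies to its inverse [U^t*].  So [U] is a unitary
    diagonal matrix, whose leading blocks intertwine those of [A] and [B];
    multiplying by unimodular diagonal matrices keeps every norm.

    Sufficiency.  By polarization the norms determine the scalar products of
    [g(A_k)] and [h(A_k)].  Number rows and columns from 0, and take
    [g = ('X - a) ^+ k] and [h = ('X - a) ^+ b] at the block of size [k + 1]:
    the only nonzero entry of [g(A_k)] is its corner, and the scalar product is
    [(N ^+ k) 0 k * ((N ^+ b) 0 k)^*].  Since this number is the same for [N]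
    and for [M], the quotients [d k] of [(M ^+ k) 0 k] by [(N ^+ k) 0 k] have
    modulus one, and [(M ^+ b) 0 k = (N ^+ b) 0 k * d k] for all [b]; that is,
    the first rows of all powers of [M] are those of [N] rescaled by the
    unitary matrix [diag_mx d].  As [krylov N] is invertible this forces
    [N *m diag_mx d = diag_mx d *m M] ([diag_similar_of_first_rows]). *)

(** * Commuting idempotents split a matrix *)

Lemma idempotent_block_similar (F : fieldType) (n p q : nat) (e : (p + q)%N = n)
    (A : 'M[F]_n) (R : 'M_(p, n)) (R' : 'M_(q, n))
    (C : 'M_(n, p)) (C' : 'M_(n, q)) :
  R *m C = 1%:M -> R' *m C' = 1%:M -> R *m C' = 0 -> R' *m C = 0 ->
  R *m A *m C' = 0 -> R' *m A *m C = 0 ->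
  similar_in unitmx A
    (castmx (e, e) (block_mx (R *m A *m C) 0 0 (R' *m A *m C'))).
Proof.
case: n / e A R R' C C' => A R R' C C' RC R'C' RC' R'C RAC' R'AC.
have PQ : col_mx R R' *m row_mx C C' = 1%:M.
  by rewrite mul_col_row RC RC' R'C R'C' -scalar_mx_block.
have [Pu _] := mulmx1_unit PQ.
exists (col_mx R R') => //=.
have Pinv : invmx (col_mx R R') = row_mx C C'.
  by rewrite -[LHS]mulmx1 -PQ mulmxA mulVmx // mul1mx.
rewrite /similar_to /= conjumx // Pinv mul_col_mx mul_col_row RAC' R'AC castmx_id.
exact: eqxx.
Qed.

(** A rank factorization [E = C *m R] has [C] left cancellable and [R] right
    cancellable, so [E *m E = E], read as [C *m (R *m C) *m R = C *m R], leaves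
    [R *m C = 1]. *)
Lemma idempotent_factor (F : fieldType) (n : nat) (E : 'M[F]_n) :
  E *m E = E ->
  exists R : 'M_(\rank E, n),
    exists2 C : 'M_(n, \rank E), R *m C = 1%:M & C *m R = E.
Proof.
move=> EE; exists (row_base E); exists (col_base E); last exact: mulmx_base.
move: (row_base_free E) (col_base_full E) (mulmx_base E).
move: (row_base E) (col_base E) => R C Rfree Cfull CR.
apply: (row_free_inj Rfree); apply: (row_full_inj Cfull) => /=.
by rewrite mul1mx !mulmxA CR -mulmxA CR.
Qed.

(** The rank factorizations of [E] and [1 - E] give bases of two complementary
    subspaces that [A] stabilizes. *)
Lemma indecomposable_idempotent (F : fieldType) (n : nat) (A E : 'M[F]_n) :
  indecomposable_mx A -> E *m E = E -> E *m A = A *m E -> E = 0 \/ E = 1%:M.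
Proof.
move=> indA EE EA.
have [->|E0] := eqVneq E 0; first by left.
have [->|E1] := eqVneq E 1%:M; first by right.
exfalso; pose E' := 1%:M - E.
have E'E' : E' *m E' = E'.
  by rewrite mulmxBl mul1mx mulmxBr mulmx1 EE subrr subr0.
have E'A : E' *m A = A *m E' by rewrite mulmxBl mulmxBr mul1mx mulmx1 EA.
have EE' : E *m E' = 0 by rewrite mulmxBr mulmx1 EE subrr.
have E'E : E' *m E = 0 by rewrite mulmxBl mul1mx EE subrr.
have [R [C RC CR]] := idempotent_factor EE.
have [R' [C' RC' CR']] := idempotent_factor E'E'.
have RE : R = R *m E by rewrite -{1}[R]mul1mx -RC -mulmxA CR.
have EC : C = E *m C by rewrite -{1}[C]mulmx1 -RC mulmxA CR.
have RE' : R' = R' *m E' by rewrite -{1}[R']mul1mx -RC' -mulmxA CR'.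
have EC' : C' = E' *m C' by rewrite -{1}[C']mulmx1 -RC' mulmxA CR'.
have RC'0 : R *m C' = 0 by rewrite RE EC' mulmxA -(mulmxA R) EE' mulmx0 mul0mx.
have R'C0 : R' *m C = 0 by rewrite RE' EC mulmxA -(mulmxA R') E'E mulmx0 mul0mx.
have RAC' : R *m A *m C' = 0.
  by rewrite RE EC' -(mulmxA R) EA mulmxA -!mulmxA (mulmxA E) EE' mul0mx !mulmx0.
have R'AC : R' *m A *m C = 0.
  by rewrite RE' EC -(mulmxA R') E'A mulmxA -!mulmxA (mulmxA E') E'E mul0mx !mulmx0.
have rank_sum : (\rank E + \rank E')%N = n.
  apply/eqP; rewrite eqn_leq; apply/andP; split.
    apply: (@mulmx1_min _ _ _ (col_mx R R') (row_mx C C')).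
    by rewrite mul_col_row RC RC' RC'0 R'C0 -scalar_mx_block.
  apply: (@mulmx1_min _ _ _ (row_mx C C') (col_mx R R')).
  by rewrite mul_row_col CR CR' addrC subrK.
have posE : (0 < \rank E)%N by rewrite lt0n mxrank_eq0.
have posE' : (0 < \rank E')%N by rewrite lt0n mxrank_eq0 subr_eq0 eq_sym.
have rE : (\rank E < n)%N by lia.
have rE' : (\rank E' < n)%N by lia.
apply: (indA _ _ rank_sum _ _ rE rE').
exact: idempotent_block_similar RC RC' RC'0 R'C0 RAC' R'AC.
Qed.

(** * Idempotents commuting with a matrix that is not a Jordan block *)

(** Write the characteristic polynomial as [q * ('X - a%:P) ^+ m] with
    [q.[a] != 0].  The idempotent is the projection onto the generalized
    eigenspace of [a], namely [f(A)] where [f] is the multiple of [q] that is 1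
    modulo [('X - a%:P) ^+ m].  It is neither 0 nor 1 because [f.[a] = 1] and
    [f.[b] = 0]. *)
Lemma idempotent_of_two_eigenvalues (F : fieldType) (n : nat) (A : 'M[F]_n.+1)
    (a b : F) :
  root (char_poly A) a -> root (char_poly A) b -> a != b ->
  exists2 E : 'M[F]_n.+1, E *m E = E /\ E *m A = A *m E & E <> 0 /\ E <> 1%:M.
Proof.
move=> ra rb ab.
have [m [q]] := multiplicity_XsubC (char_poly A) a.
rewrite monic_neq0 ?char_poly_monic //= => qa charE.
have cop : coprimep (('X - a%:P) ^+ m) q.
  by rewrite coprimep_expl // coprimep_sym coprimep_XsubC.
have /Bezout_eq1_coprimepP[[u v] /= uv] := cop.
have qb : root q b.
  move: rb; rewrite charE rootM => /orP[//|].
  case: (m) => [|m']; first by rewrite expr0 (negPf (root1 b)).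
  by rewrite root_exp_XsubC eq_sym (negPf ab).
have m0 : (0 < m)%N.
  by case: m charE {uv cop} => // charE; move: ra; rewrite charE mulr1 (negPf qa).
pose f := v * q; pose f' := 1 - f.
have f'E : f' = u * ('X - a%:P) ^+ m by rewrite /f' -uv addrK.
have fa : ~~ root f a.
  have -> : f = 1 - f' by rewrite /f' opprB addrC subrK.
  rewrite rootE hornerD hornerN f'E hornerM horner_exp hornerXsubC subrr.
  by rewrite expr0n -(prednK m0) mulr0 subr0 hornerC oner_eq0.
have f'b : ~~ root f' b.
  by rewrite rootE /f' hornerD hornerN hornerC hornerM (rootP qb) mulr0 subr0 oner_eq0.
have nonzero (g : {poly F}) c : root (char_poly A) c -> ~~ root g c ->
    horner_mx A g <> 0.
  rewrite -root_mxminpoly => rc; apply: contraNnot => /mxminpoly_min.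
  by move=> /root_dvdp; apply.
have ann : horner_mx A (f * f') = 0.
  have -> : f * f' = v * u * char_poly A by rewrite f'E /f charE; ring.
  by rewrite rmorphM /= Cayley_Hamilton mulr0.
exists (horner_mx A f); split.
- have : horner_mx A f * (1 - horner_mx A f) = 0.
    by rewrite -ann [RHS]rmorphM rmorphB rmorph1.
  by rewrite mulrBr mulr1 => /eqP; rewrite subr_eq0 => /eqP/esym.
- exact/comm_horner_mx/comm_mx_refl.
- exact: nonzero ra fa.
move=> f1; apply: (nonzero f' b rb f'b).
by rewrite rmorphB rmorph1 /= f1 subrr.
Qed.

(** Let [(N ^+ d) i j] be nonzero.  The columns [j] of [1, N, ..., N ^+ d] span
    an [N]-stable space, and the rows [i] of the same powers cut out an
    [N]-stable space; the two are complementary because the pairing matrix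
    [G] between these columns and rows is triangular with constant diagonal
    [(N ^+ d) i j].  The idempotent is the projection onto the first space
    along the second, whose rank [d.+1] is too small for the identity. *)
Lemma idempotent_of_nilpotent (F : fieldType) (n d : nat) (N : 'M[F]_n.+1) :
  N ^+ d <> 0 -> N ^+ d.+1 = 0 -> (d < n)%N ->
  exists2 E : 'M[F]_n.+1, E *m E = E /\ E *m N = N *m E & E <> 0 /\ E <> 1%:M.
Proof.
move=> Nd NSd dn.
have [i [j Nij]] : exists i j, (N ^+ d) i j != 0.
  by apply/matrix0Pn/eqP.
have N0 k : (d < k)%N -> N ^+ k = 0.
  by move=> dk; rewrite -(subnK dk) exprD NSd mulr0.
(* The columns of [Q] are listed by decreasing powers, so that one and the same
   shift [S] describes [N] on the rows of [P] and on the columns of [Q]; this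
   is why [S] commutes with [G], and [N] with the projection. *)
pose P := \matrix_(b < d.+1, k < n.+1) (N ^+ b) i k.
pose Q := \matrix_(k < n.+1, c < d.+1) (N ^+ (d - c)) k j.
pose S : 'M[F]_d.+1 := \matrix_(b, c) (c == b.+1 :> nat)%:R.
have PN : P *m N = S *m P.
  apply/matrixP=> b k; rewrite !mxE.
  transitivity ((N ^+ b.+1) i k).
    by rewrite exprSr mxE; apply: eq_bigr => l _; rewrite mxE.
  have [bd|db] := ltnP b d.
    rewrite (bigD1 (Ordinal (bd : b.+1 < d.+1)%N)) //= !mxE eqxx mul1r big1 ?addr0 //.
    by move=> c cb; rewrite !mxE -val_eqE /= in cb *; rewrite (negPf cb) mul0r.
  rewrite N0 // mxE big1 // => c _; rewrite !mxE.
  by case: eqP => [E|]; rewrite ?mul0r //; move: (ltn_ord c); lia.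
have NQ : N *m Q = Q *m S.
  apply/matrixP=> k c; rewrite !mxE.
  transitivity ((N ^+ (d - c).+1) k j).
    by rewrite exprS mxE; apply: eq_bigr => l _; rewrite mxE.
  have [c0|c0] := posnP c.
    rewrite c0 subn0 NSd mxE big1 // => b _.
    by rewrite !mxE c0 mulr0.
  have bd : (c.-1 < d.+1)%N by move: (ltn_ord c); lia.
  rewrite (bigD1 (Ordinal bd)) //= !mxE /= prednK // eqxx mulr1 big1 ?addr0.
    by congr (fun_of_matrix (N ^+ _) _ _); move: (ltn_ord c); lia.
  move=> b; rewrite -val_eqE !mxE /= => bc.
  by rewrite (_ : (c == b.+1 :> nat) = false) ?mulr0 //; lia.
pose G := P *m Q.
have GE b c : G b c = (N ^+ (b + (d - c))) i j.
  by rewrite exprD !mxE; apply: eq_bigr => l _; rewrite !mxE.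
have trigG : is_trig_mx G^T.
  apply/is_trig_mxP => b c bc; rewrite mxE GE N0 ?mxE //.
  by move: (ltn_ord b) (ltn_ord c); lia.
have Gu : G \in unitmx.
  rewrite unitmxE -det_tr det_trig // unitfE; apply/prodf_neq0 => b _.
  by rewrite mxE GE subnKC // -ltnS.
have SG : S *m G = G *m S by rewrite /G mulmxA -PN -!mulmxA NQ.
have SGV : S *m invmx G = invmx G *m S.
  rewrite -[LHS]mul1mx -(mulVmx Gu) -mulmxA (mulmxA G) -SG.
  by rewrite -(mulmxA S) mulmxV // mulmx1.
exists (Q *m invmx G *m P); split.
- rewrite !mulmxA -[in LHS](mulmxA _ P) -/G -(mulmxA _ _ G).
  by rewrite mulVmx // mulmx1.
- by rewrite -!mulmxA PN !mulmxA NQ -!mulmxA; congr (_ *m _); rewrite !mulmxA SGV.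
- move=> E0; have : P *m (Q *m invmx G *m P) *m Q = 0 by rewrite E0 mulmx0 mul0mx.
  rewrite !mulmxA -/G mulmxV // mul1mx -/G => G0.
  by move: Gu; rewrite G0 unitmxE det0 ?unitr0.
- move=> E1; have /mulmx1_min : Q *m (invmx G *m P) = 1%:M by rewrite mulmxA.
  by lia.
Qed.

(** * Strictly upper triangular matrices *)

(** Upper triangular ([d = 0]) and strictly upper triangular ([d = 1]) matrices
    are treated as levels of one filtration because products add the levels. *)
Definition zero_below (F : fieldType) (n d : nat) (M : 'M[F]_n) : Prop :=
  forall i j : 'I_n, (j < i + d)%N -> M i j = 0.

Lemma upper_trig_zero_below (F : fieldType) (n : nat) (A : 'M[F]_n) :
  is_upper_trig_mx A -> zero_below 0 A.
Proof.
move=> /is_trig_mxP trigA i j; rewrite addn0 => ji.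
by have := trigA j i ji; rewrite mxE.
Qed.

Lemma zero_below_shift (F : fieldType) (n : nat) (a : F) (A : 'M[F]_n) :
  zero_below 0 A -> zero_below 0 (A - a%:M).
Proof.
move=> A0 i j ij; rewrite !mxE A0 // -val_eqE /= gtn_eqF ?subr0 //.
by rewrite -[i : nat]addn0.
Qed.

(** On the first superdiagonal that can be nonzero, only one intermediate index
    contributes to a product. *)
Lemma zero_below_mul_diag (F : fieldType) (n d e : nat) (M N : 'M[F]_n)
    (i l j : 'I_n) :
  zero_below d M -> zero_below e N -> l = (i + d)%N :> nat ->
  j = (l + e)%N :> nat -> (M *m N) i j = M i l * N l j.
Proof.
move=> Md Ne il lj; rewrite mxE (bigD1 l) //= big1 ?addr0 // => k.
rewrite -val_eqE /= => kl; have [ki|ik] := ltnP k (i + d)%N.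
  by rewrite Md ?mul0r.
by rewrite Ne ?mulr0 //; lia.
Qed.

Lemma zero_belowM (F : fieldType) (n d e : nat) (M N : 'M[F]_n) :
  zero_below d M -> zero_below e N -> zero_below (d + e) (M *m N).
Proof.
move=> Md Ne i j ij; rewrite mxE big1 // => k _.
have [ki|ik] := ltnP k (i + d)%N; first by rewrite Md ?mul0r.
by rewrite Ne ?mulr0 //; lia.
Qed.

Lemma zero_belowX (F : fieldType) (n b : nat) (N : 'M[F]_n.+1) :
  zero_below 1 N -> zero_below b (N ^+ b).
Proof.
move=> N1; elim: b => [|b IHb].
  move=> i j ij; rewrite expr0 mxE; case: eqP => // E.
  by move: ij; rewrite E; lia.
by rewrite exprSr -[b.+1]addn1; apply: zero_belowM.
Qed.

Arguments zero_belowX {F n} b {N}.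

(** The top right corner is the only entry of [N ^+ n] that can be nonzero, and
    it is the product [(N ^+ k) 0 k * (N ^+ (n - k)) k n]. *)
Lemma corner_neq0 (F : fieldType) (n : nat) (N : 'M[F]_n.+1) (k : 'I_n.+1) :
  zero_below 1 N -> N ^+ n <> 0 -> (N ^+ k) 0 k != 0.
Proof.
move=> N1; apply: contra_notN => /eqP Nk0; apply/matrixP => i j.
have [->|i0] := eqVneq i 0; last first.
  rewrite (zero_belowX n N1) ?mxE //; rewrite -val_eqE /= in i0.
  by move: (ltn_ord j); lia.
have [->|jn] := eqVneq j ord_max; last first.
  rewrite (zero_belowX n N1) ?mxE //; rewrite -val_eqE /= in jn.
  by move: (ltn_ord j); lia.
have kn : (k <= n)%N by rewrite -ltnS.
have -> : N ^+ n = N ^+ k *m N ^+ (n - k) by rewrite mulmxE -exprD subnKC.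
rewrite (zero_below_mul_diag (l := k) (zero_belowX k N1) (zero_belowX _ N1)) //=.
  by rewrite Nk0 mul0r mxE.
by rewrite subnKC.
Qed.

Lemma upper_trig_diag_eigenvalue (F : fieldType) (n : nat) (A : 'M[F]_n)
    (i : 'I_n) :
  is_upper_trig_mx A -> root (char_poly A) (A i i).
Proof.
move=> trigA; have -> : char_poly A = char_poly A^T.
  rewrite /char_poly -det_tr; congr (\det _).
  by apply/matrixP=> j k; rewrite !mxE eq_sym.
rewrite char_poly_trig // rootE horner_prod; apply/eqP.
by rewrite (bigD1 i) //= hornerXsubC mxE subrr mul0r.
Qed.

(** By indecomposability all diagonal entries agree, and the last power of the
    nilpotent part that could be nonzero is. *)
Lemma indecomposable_trig_shift (F : fieldType) (n : nat) (A : 'M[F]_n.+1)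
    (N := A - (A 0 0)%:M) :
  is_upper_trig_mx A -> indecomposable_mx A -> zero_below 1 N /\ N ^+ n <> 0.
Proof.
move=> trigA indA.
have diagA i : A i i = A 0 0.
  apply/eqP/negPn/negP => neq.
  have [E [EE EA] [E0 E1]] := idempotent_of_two_eigenvalues
    (upper_trig_diag_eigenvalue i trigA) (upper_trig_diag_eigenvalue 0 trigA) neq.
  by case: (indecomposable_idempotent indA EE EA).
have N1 : zero_below 1 N.
  move=> i j; rewrite addn1 ltnS leq_eqVlt => /orP[/eqP/val_inj->|ji].
    by rewrite !mxE eqxx diagA subrr.
  have Aij : A i j = 0 by rewrite (upper_trig_zero_below trigA) ?addn0.
  by rewrite !mxE Aij -val_eqE /= gtn_eqF // subr0.
split=> // Nn.
have ex_nil : exists d, N ^+ d == 0 by exists n; apply/eqP.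
case: (ex_minnP ex_nil) => [[|d] /eqP Nd mind].
  by move/eqP: Nd; rewrite expr0 oner_eq0.
have dn : (d < n)%N by apply: mind; apply/eqP.
have Nd0 : N ^+ d <> 0.
  by move=> /eqP/mind; rewrite ltnn.
have [E [EE EN] [E0 E1]] := idempotent_of_nilpotent Nd0 Nd dn.
have EA : E *m A = A *m E.
  have -> : A = N + (A 0 0)%:M by rewrite subrK.
  by rewrite mulmxDl mulmxDr EN scalar_mxC.
by case: (indecomposable_idempotent indA EE EA).
Qed.

(** * Krylov matrices and intertwiners *)

(** The matrix of the powers of [N] applied to the first coordinate functional,
    which is a cyclic vector for the action of [N] on rows. *)
Definition krylov (F : fieldType) (n : nat) (N : 'M[F]_n.+1) : 'M[F]_n.+1 :=
  \matrix_(b, k) (N ^+ b) 0 k.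

Lemma krylov_upper (F : fieldType) (n : nat) (N : 'M[F]_n.+1) :
  zero_below 1 N -> zero_below 0 (krylov N).
Proof.
by move=> N1 b k kb; rewrite mxE (zero_belowX b N1) //= add0n; rewrite addn0 in kb.
Qed.

Lemma krylov_unit (F : fieldType) (n : nat) (N : 'M[F]_n.+1) :
  zero_below 1 N -> N ^+ n <> 0 -> krylov N \in unitmx.
Proof.
move=> N1 Nn; rewrite unitmxE -det_tr det_trig.
  by rewrite unitfE; apply/prodf_neq0 => k _; rewrite !mxE corner_neq0.
apply/is_trig_mxP => b k bk; rewrite mxE krylov_upper //.
by rewrite addn0.
Qed.

Lemma krylov_mul (F : fieldType) (n : nat) (N X : 'M[F]_n.+1) (b j : 'I_n.+1) :
  (krylov N *m X) b j = (N ^+ b *m X) 0 j.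
Proof. by rewrite !mxE; apply: eq_bigr => k _; rewrite mxE. Qed.

(** Back substitution: column [j] of [U] is cleared from the last row upwards. *)
Lemma upper_mul_cancel (F : fieldType) (n : nat) (T U : 'M[F]_n) :
  zero_below 0 T -> T \in unitmx -> zero_below 0 (T *m U) -> zero_below 0 U.
Proof.
move=> T0 Tu TU0.
have Tii i : T i i != 0.
  move: Tu; rewrite unitmxE -det_tr det_trig.
    by rewrite unitfE => /prodf_neq0/(_ i isT); rewrite mxE.
  by apply/is_trig_mxP => j k jk; rewrite mxE T0 ?addn0.
move=> i j; rewrite addn0.
move: {2}(n - i)%N (leqnn (n - i)) => m; elim: m i => [|m IHm] i im ji.
  by move: (ltn_ord i); lia.
have : (T *m U) i j = 0 by rewrite TU0 ?addn0.
rewrite mxE (bigD1 i) //= big1 ?addr0 => [|k].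
  by move/eqP; rewrite mulf_eq0 (negPf (Tii i)) => /eqP.
rewrite -val_eqE /= => ki; have [k_i|i_k] := ltnP k i.
  by rewrite T0 ?addn0 ?mul0r.
by rewrite IHm ?mulr0 //; lia.
Qed.

Lemma horner_mx_intertwine (F : fieldType) (n : nat) (A B D : 'M[F]_n.+1)
    (h : {poly F}) :
  A *m D = D *m B -> horner_mx A h *m D = D *m horner_mx B h.
Proof.
move=> AD; elim/poly_ind: h => [|h c IHh]; first by rewrite !rmorph0 mul0mx mulmx0.
rewrite !rmorphD !rmorphM /= !horner_mx_X !horner_mx_C mulmxDl mulmxDr.
by rewrite scalar_mxC -!mulmxE -mulmxA AD !mulmxA IHh.
Qed.

(** Row [b] of [krylov N *m U] is the first row of [U *m M ^+ b], whose first
    [b] entries vanish. *)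
Lemma intertwiner_upper (F : fieldType) (n : nat) (N M U : 'M[F]_n.+1) :
  zero_below 1 N -> N ^+ n <> 0 -> zero_below 1 M -> N *m U = U *m M ->
  zero_below 0 U.
Proof.
move=> N1 Nn M1 NU.
apply: (upper_mul_cancel (krylov_upper N1) (krylov_unit N1 Nn)) => b j.
have := horner_mx_intertwine 'X^b NU; rewrite !rmorphXn /= !horner_mx_X => NbU.
rewrite addn0 krylov_mul NbU mxE => jb.
by rewrite big1 // => l _; rewrite (zero_belowX b M1) ?mulr0 //; lia.
Qed.

(** The inverse of [U] intertwines [M] and [N], so it is upper triangular as
    well; but it is the conjugate transpose of [U]. *)
Lemma unitary_intertwiner_diag (C : numClosedFieldType) (n : nat)
    (N M U : 'M[C]_n.+1) :
  zero_below 1 N -> N ^+ n <> 0 -> zero_below 1 M -> M ^+ n <> 0 ->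
  U \is unitarymx -> N *m U = U *m M -> is_diag_mx U.
Proof.
move=> N1 Nn M1 Mn Uu NU; set V := invmx U.
have Vup : zero_below 0 V.
  apply: (intertwiner_upper M1 Mn N1).
  have Uunit := unitarymx_unit Uu.
  by rewrite -[LHS](mulKmx Uunit) (mulmxA U) -NU -mulmxA mulmxV // mulmx1.
apply/is_diag_mxP => i j; rewrite neq_ltn => /orP[ij|ji].
  have := Vup j i; rewrite addn0 /V invmx_unitary // !mxE => /(_ ij)/eqP.
  by rewrite conjC_eq0 => /eqP.
by rewrite (intertwiner_upper N1 Nn M1 NU) ?addn0.
Qed.

(** * The Frobenius scalar product *)

Definition frob_dot (C : numClosedFieldType) (m n : nat) (X Y : 'M[C]_(m, n)) : C :=
  \sum_i \sum_j X i j * (Y i j)^*.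

Lemma frobenius_norm_sqr (C : numClosedFieldType) (m n : nat) (X : 'M[C]_(m, n)) :
  frobenius_norm X ^+ 2 = frob_dot X X.
Proof.
rewrite sqrtCK; apply: eq_bigr => i _; apply: eq_bigr => j _.
by rewrite normCK.
Qed.

(** The four terms run over the fourth roots of unity [c]; in the sum of
    [c * |x + c y|^2] only the four copies of [x * y^*] survive. *)
Lemma frob_dot_polarization (C : numClosedFieldType) (m n : nat)
    (X Y : 'M[C]_(m, n)) :
  frob_dot X Y *+ 4 =
    frob_dot (X + Y) (X + Y) - frob_dot (X - Y) (X - Y)
    + 'i * frob_dot (X + 'i *: Y) (X + 'i *: Y)
    - 'i * frob_dot (X - 'i *: Y) (X - 'i *: Y).
Proof.
rewrite /frob_dot !pair_bigA /= !mulr_sumr -sumrMnl -!sumrB -big_split -sumrB /=.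
apply: eq_bigr => -[i j] _ /=; rewrite !mxE; move: (X i j) (Y i j) => x y.
rewrite !(rmorphD, rmorphN, rmorphM) /= conjCi.
apply/eqP; rewrite -subr_eq0; apply/eqP.
(* As an identity in free variables the two sides differ by a multiple of
   ['i ^+ 2 + 1]. *)
transitivity (2 * ('i ^+ 2 + 1) * (x * y^* - y * x^*)); first by ring.
by rewrite sqrCi addNr mulr0 mul0r.
Qed.

Lemma frob_dot_horner_eq (C : numClosedFieldType) (n : nat) (A B : 'M[C]_n.+1) :
  (forall h : {poly C},
     frobenius_norm (horner_mx A h) = frobenius_norm (horner_mx B h)) ->
  forall g h : {poly C},
    frob_dot (horner_mx A g) (horner_mx A h) =
    frob_dot (horner_mx B g) (horner_mx B h).
Proof.
move=> AB g h.
have sqr_eq f : frob_dot (horner_mx A f) (horner_mx A f) =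
                frob_dot (horner_mx B f) (horner_mx B f).
  by rewrite -!frobenius_norm_sqr AB.
apply: (@mulIf C 4%:R); first by rewrite pnatr_eq0.
rewrite !mulr_natr !frob_dot_polarization -!horner_mxZ.
by rewrite -!(rmorphD, rmorphB) /= !sqr_eq.
Qed.

(** * Leading principal blocks *)

(** When the right factor is upper triangular the first [k.+1] columns of the
    product only involve the first [k.+1] rows of that factor, and of the left
    one the first [k.+1] columns. *)
Lemma principal_mxM (F : fieldType) (n : nat) (k : 'I_n) (X Y : 'M[F]_n) :
  zero_below 0 Y ->
  principal_mx k (X *m Y) = principal_mx k X *m principal_mx k Y.
Proof.
move=> Y0; apply/matrixP => i j; rewrite !mxE.
rewrite (bigID (fun l : 'I_n => l < k.+1)%N) /= [X in _ + X]big1 ?addr0 => [|l lk].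
  by rewrite (big_ord_narrow (ltn_ord k)); apply: eq_bigr => l _; rewrite !mxE.
by rewrite Y0 ?mulr0 //=; move: (ltn_ord j); lia.
Qed.

Lemma principal_mx_scalar (F : fieldType) (n : nat) (k : 'I_n) (a : F) :
  principal_mx k a%:M = a%:M.
Proof. by apply/matrixP => i j; rewrite !mxE. Qed.

Lemma principal_mxX (F : fieldType) (n : nat) (k : 'I_n.+1) (b : nat)
    (X : 'M[F]_n.+1) :
  zero_below 0 X -> principal_mx k (X ^+ b) = principal_mx k X ^+ b.
Proof.
move=> X0; elim: b => [|b IHb]; first exact: principal_mx_scalar.
by rewrite !exprSr -!mulmxE principal_mxM // IHb.
Qed.

Lemma principal_mx_horner_XsubC (F : fieldType) (n : nat) (k : 'I_n.+1) (b : nat)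
    (a : F) (A : 'M[F]_n.+1) :
  zero_below 0 A ->
  horner_mx (principal_mx k A) (('X - a%:P) ^+ b) =
  principal_mx k ((A - a%:M) ^+ b).
Proof.
move=> A0; rewrite principal_mxX; last exact: zero_below_shift.
rewrite rmorphXn rmorphB /= horner_mx_X horner_mx_C; congr (_ ^+ _).
by apply/matrixP => i j; rewrite !mxE.
Qed.

(** The top right corner of the leading block of [X] is its only nonzero entry. *)
Lemma frob_dot_corner (C : numClosedFieldType) (n : nat) (k : 'I_n.+1)
    (X Y : 'M[C]_n.+1) :
  zero_below k X ->
  frob_dot (principal_mx k X) (principal_mx k Y) = X 0 k * (Y 0 k)^*.
Proof.
move=> Xk; rewrite /frob_dot (bigD1 0) //= [X in _ + X]big1 ?addr0 => [|i i0].
  rewrite (bigD1 ord_max) //= big1 ?addr0 => [|j jk].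
    by rewrite !mxE; congr (X _ _ * (Y _ _)^*); apply: val_inj.
  rewrite -val_eqE /= in jk; rewrite !mxE Xk ?mul0r //=.
  by move: (ltn_ord j); lia.
rewrite -val_eqE /= in i0; apply: big1 => j _; rewrite !mxE Xk ?mul0r //=.
by move: (ltn_ord j); lia.
Qed.

(** * Diagonal unitary similarity *)

(** The hypothesis says [krylov M = krylov N *m diag_mx d], and for [b.+1] it
    compares row [b] of [krylov M *m M] with row [b] of [krylov N *m N]; so
    [krylov N] multiplied by either side gives the same matrix. *)
Lemma diag_similar_of_first_rows (F : fieldType) (n : nat) (N M : 'M[F]_n.+1)
    (d : 'rV[F]_n.+1) :
  krylov N \in unitmx ->
  (forall (b : nat) (k : 'I_n.+1), (M ^+ b) 0 k = (N ^+ b) 0 k * d 0 k) ->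
  N *m diag_mx d = diag_mx d *m M.
Proof.
move=> Ku rows; apply: (can_inj (mulKmx Ku)); apply/matrixP => b k.
have KM : krylov M = krylov N *m diag_mx d.
  by apply/matrixP => c l; rewrite mul_mx_diag !mxE rows.
rewrite [in RHS]mulmxA -KM !krylov_mul mulmxA mulmxE -!exprSr rows.
by rewrite -mulmxE mul_mx_diag mxE.
Qed.

Lemma frobenius_norm_unimodular (C : numClosedFieldType) (m n : nat)
    (X Y : 'M[C]_(m, n)) (d : 'rV[C]_m) (e : 'rV[C]_n) :
  (forall i, `|d 0 i| = 1) -> (forall j, `|e 0 j| = 1) ->
  X *m diag_mx e = diag_mx d *m Y -> frobenius_norm X = frobenius_norm Y.
Proof.
move=> d1 e1 XY; congr sqrtC; apply: eq_bigr => i _; apply: eq_bigr => j _.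
have := congr1 (fun Z : 'M_(m, n) => `|Z i j|) XY.
by rewrite /= mul_mx_diag mul_diag_mx !mxE !normrM d1 e1 mulr1 mul1r => ->.
Qed.

Lemma unitary_diag_mxP (C : numClosedFieldType) (n : nat) (d : 'rV[C]_n) :
  reflect (forall i, `|d 0 i| = 1) (diag_mx d \is unitarymx).
Proof.
have DD : diag_mx d *m ((diag_mx d)^t*)%sesqui = diag_mx (\row_i (`|d 0 i| ^+ 2)).
  apply/matrixP => i j; rewrite mul_diag_mx !mxE.
  by have [->|ij] := eqVneq i j; rewrite ?eqxx ?normCK //= conjC0 mulr0.
apply: (iffP unitarymxP) => [|d1]; rewrite DD.
  move=> /matrixP E i; have := E i i; rewrite !mxE eqxx => /eqP.
  by rewrite sqrp_eq1 // => /eqP.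
by apply/matrixP => i j; rewrite !mxE d1 expr1n.
Qed.

(** * The criterion *)

Lemma unitarily_similar_frobenius (C : numClosedFieldType) (n : nat)
    (A B : 'M[C]_n.+1) :
  is_upper_trig_mx A -> is_upper_trig_mx B ->
  indecomposable_mx A -> indecomposable_mx B ->
  unitarily_similar A B ->
  forall (h : {poly C}) (k : 'I_n.+1),
    frobenius_norm (horner_mx (principal_mx k A) h) =
    frobenius_norm (horner_mx (principal_mx k B) h).
Proof.
move=> trigA trigB indA indB [U Uu AUB] h k.
have [N1 Nn] := indecomposable_trig_shift trigA indA.
have [M1 Mn] := indecomposable_trig_shift trigB indB.
have Uunit := unitarymx_unit Uu.
have AU : A *m U = U *m B by rewrite -AUB !mulmxA mulmxV // mul1mx.
have diagE (X : 'M[C]_n.+1) : zero_below 1 (X - (X 0 0)%:M) ->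
    \tr X = X 0 0 *+ n.+1.
  move=> X1; rewrite -[X in LHS](subrK (X 0 0)%:M) mxtraceD mxtrace_scalar.
  by rewrite [\tr _]big1 ?add0r // => i _; rewrite X1 ?addn1.
(* Similar matrices have the same trace, here [n.+1] times the eigenvalue. *)
have ab : A 0 0 = B 0 0.
  apply/eqP; rewrite -(@eqr_pMn2r _ n.+1) // -!diagE //; apply/eqP.
  by rewrite -AUB mxtrace_mulC mulmxA mulmxV // mul1mx.
have NU : (A - (A 0 0)%:M) *m U = U *m (B - (B 0 0)%:M).
  by rewrite mulmxBl mulmxBr AU ab scalar_mxC.
have /diag_mxP[d UE] := unitary_intertwiner_diag N1 Nn M1 Mn Uu NU.
have /unitary_diag_mxP d1 : diag_mx d \is unitarymx by rewrite -UE.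
pose dk := \row_(i < k.+1) d 0 (widen_ord (ltn_ord k) i).
have Dk : principal_mx k (diag_mx d) = diag_mx dk.
  by apply/matrixP => i j; rewrite !mxE.
have dk1 i : `|dk 0 i| = 1 by rewrite mxE.
have D0 : zero_below 0 (diag_mx d).
  by move=> i j; rewrite addn0 !mxE => ji; rewrite -val_eqE /= gtn_eqF.
apply: (frobenius_norm_unimodular dk1 dk1); apply: horner_mx_intertwine.
rewrite -Dk -!principal_mxM //; last exact: upper_trig_zero_below.
by rewrite -UE AU.
Qed.

Lemma frobenius_unitarily_similar (C : numClosedFieldType) (n : nat)
    (A B : 'M[C]_n.+1) :
  is_upper_trig_mx A -> is_upper_trig_mx B ->
  indecomposable_mx A -> indecomposable_mx B ->
  (forall (h : {poly C}) (k : 'I_n.+1),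
    frobenius_norm (horner_mx (principal_mx k A) h) =
    frobenius_norm (horner_mx (principal_mx k B) h)) ->
  unitarily_similar A B.
Proof.
move=> trigA trigB indA indB AB.
have [N1 Nn] := indecomposable_trig_shift trigA indA.
have [M1 Mn] := indecomposable_trig_shift trigB indB.
have A0 := upper_trig_zero_below trigA.
have B0 := upper_trig_zero_below trigB.
(* The block of size one, evaluated at ['X - A 0 0], detects the eigenvalue. *)
have ab : A 0 0 = B 0 0.
  have := frob_dot_horner_eq (AB^~ 0) ('X - (A 0 0)%:P) ('X - (A 0 0)%:P).
  rewrite -['X - _]expr1 !principal_mx_horner_XsubC // !frob_dot_corner.
  - rewrite !expr1 !mxE /= subrr mul0r => /esym/eqP.
    by rewrite mulf_eq0 conjC_eq0 orbb subr_eq0 => /eqP.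
  - by rewrite expr1; apply: zero_below_shift.
  - by rewrite expr1; apply: zero_below_shift.
move: (A 0 0) (B 0 0) ab N1 Nn M1 Mn => a _ <-.
set N := A - a%:M; set M := B - a%:M => N1 Nn M1 Mn.
have corner (b : nat) (k : 'I_n.+1) :
    (N ^+ k) 0 k * ((N ^+ b) 0 k)^* = (M ^+ k) 0 k * ((M ^+ b) 0 k)^*.
  have := frob_dot_horner_eq (AB^~ k) (('X - a%:P) ^+ k) (('X - a%:P) ^+ b).
  by rewrite !principal_mx_horner_XsubC // !frob_dot_corner //; apply: zero_belowX.
have Nk (k : 'I_n.+1) : (N ^+ k) 0 k != 0 by apply: corner_neq0.
have Mk (k : 'I_n.+1) : (M ^+ k) 0 k != 0 by apply: corner_neq0.
pose d := \row_(k < n.+1) ((M ^+ k) 0 k / (N ^+ k) 0 k).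
have norm_corner (k : 'I_n.+1) : `|(N ^+ k) 0 k| = `|(M ^+ k) 0 k|.
  by apply/eqP; rewrite -(eqrXn2 (n := 2)) // !normCK corner.
have d1 k : `|d 0 k| = 1.
  by rewrite mxE normf_div norm_corner divff // normr_eq0.
have rows (b : nat) (k : 'I_n.+1) : (M ^+ b) 0 k = (N ^+ b) 0 k * d 0 k.
  have /(congr1 Num.conj) := corner b k; rewrite !rmorphM /= !conjCK => conj_corner.
  have dd : (d 0 k)^* * d 0 k = 1 by rewrite mulrC -normCK d1 expr1n.
  have NMk : (N ^+ k) 0 k * d 0 k = (M ^+ k) 0 k by rewrite mxE mulrC divfK.
  apply: (mulfI (x := ((N ^+ k) 0 k)^*)); first by rewrite conjC_eq0.
  rewrite mulrA conj_corner -NMk rmorphM /=.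
  by rewrite -[LHS]mulr1 -dd; ring.
have Uu : diag_mx d \is unitarymx by apply/unitary_diag_mxP.
exists (diag_mx d) => //; rewrite -mulmxA.
have ND := diag_similar_of_first_rows (krylov_unit N1 Nn) rows.
have -> : A *m diag_mx d = diag_mx d *m B.
  rewrite -[A](subrK a%:M) -[B](subrK a%:M) mulmxDl mulmxDr ND.
  by rewrite scalar_mxC.
by rewrite mulKmx // unitarymx_unit.
Qed.

Theorem theorem1 (R : realType) (n : nat) (A B : 'M[R[i]]_n)
    (trigA : is_upper_trig_mx A) (trigB : is_upper_trig_mx B)
    (indecA : indecomposable_mx A) (indecB : indecomposable_mx B) :
  unitarily_similar A B <->
  (forall (h : {poly R[i]}) (k : 'I_n),
     frobenius_norm (horner_mx (principal_mx k A) h) =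
     frobenius_norm (horner_mx (principal_mx k B) h)).
Proof.
case: n A B trigA trigB indecA indecB => [|n] A B trigA trigB indecA indecB.
  split=> [_ h k|_]; first by exfalso; case: k.
  exists 1%:M; first apply/unitarymxP;
    by apply/matrixP => i; exfalso; case: i.
(* The matrices of the statement live over the field structure that [R[i]] has
   for every real field, and the two lemmas over the one underlying its
   [numClosedFieldType]; with every argument given the two are convertible at
   once, whereas unification would unfold the complex operations. *)
split=> [AB h k|AB].
  exact (@unitarily_similar_frobenius R[i] n A B trigA trigB indecA indecB AB h k).
apply: (@frobenius_unitarily_similar R[i] n A B trigA trigB indecA indecB) => h k.
exact (AB h k).
Qed.
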